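(* Let $\mathcal{C}$ be a pruned interpolant of an implication $A\to B$. Then there is an $\mathbf{LK}^-$ proof $\pi$ of the split sequent $A;\Rightarrow;B$ such that $\mathcal{C}$ subsumes $\mathrm{CNF}(\mathcal{M}(\pi))$.
   Context: Propositional formulas are built from atoms and $\bot$ using $\wedge,\vee,\neg$; $A\to B$ abbreviates $\neg A\vee B$; $\top$ abbreviates $\neg\bot\vee\bot$. $V(A)$ is the set of atoms of $A$. A literal is an atom (counting $\bot$ as an atom), a negated atom, or $\top$. A clause is a finite set of literals (read as disjunction), a clause set a set of clauses (read as conjunction). A clause set is pruned if no atom $p$ occurs in it both as $p$ and as $\neg p$ and it does not contain the literal $\top$. An interpolant of a valid $A\to B$ is a formula or clause set $C$ with $V(C)\subseteq V(A)\cap V(B)$ such that $A\to C$ and $C\to B$ are valid. A pruned interpolant of $A\to B$ is a pruned clause set $\mathcal{C}$ that is an interpolant of $A\to B$ such that there are no clauses $C'\subsetneq C\in\mathcal{C}$ with $A\models C'$. A clause set $\mathcal{A}$ subsumes $\mathcal{B}$ if for every $B\in\mathcal{B}$ there is $A\in\mathcal{A}$ with $A\subseteq B$. $\mathcal{C}\times\mathcal{D}=\{C\cup D\mid C\in\mathcal{C},D\in\mathcal{D}\}$; $\mathrm{CNF}$ is defined on formulas built from literals by $\wedge,\vee$: $\mathrm{CNF}(\top)=\emptyset$, $\mathrm{CNF}(\bot)=\{\emptyset\}$, $\mathrm{CNF}(\ell)=\{\{\ell\}\}$ for other literals, $\mathrm{CNF}(A\wedge B)=\mathrm{CNF}(A)\cup\mathrm{CNF}(B)$,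 $\mathrm{CNF}(A\vee B)=\mathrm{CNF}(A)\times\mathrm{CNF}(B)$. $\mathbf{LK}^-$ is the cut-free sequent calculus with axioms $p\Rightarrow p$ ($p$ an atom) and $\bot\Rightarrow$, and rules weakening, contraction, $(L\wedge_1),(L\wedge_2),(R\wedge),(R\vee_1),(R\vee_2),(L\vee),(L\neg),(R\neg)$ in standard Gentzen G1 form. A split sequent $\Gamma_1;\Gamma_2\Rightarrow\Delta_1;\Delta_2$ is the sequent $\Gamma_1,\Gamma_2\Rightarrow\Delta_1,\Delta_2$ with formulas divided into a left side ($\Gamma_1,\Delta_1$) and a right side ($\Gamma_2,\Delta_2$); in a proof of a split sequent every sequent is split, context formulas keep their side and auxiliary formulas lie on the side of the main formula. The Maehara interpolant $\mathcal{M}(\pi)$: axioms $p;\Rightarrow p;$ give $\bot$, $;p\Rightarrow;p$ give $\top$, $p;\Rightarrow;p$ give $p$, $;p\Rightarrow p;$ give $\neg p$, $\bot;\Rightarrow;$ gives $\bot$, $;\bot\Rightarrow;$ gives $\top$; unary rules keep the premise's interpolant; a binary rule ($(R\wedge)$ or $(L\vee)$) with premise proofs $\pi_1,\pi_2$ gives $\mathcal{M}(\pi_1)\vee\mathcal{M}(\pi_2)$ if its main formula is on the left side and $\mathcal{M}(\pi_1)\wedge\mathcal{M}(\pi_2)$ if on the right side. *)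

(* Defs.v *)
From HB Require Import structures.
From mathcomp Require Import all_boot.
From mathcomp Require Import finmap multiset.
From mathcomp Require Import boolp classical_sets.

Set Implicit Arguments.
Unset Strict Implicit.
Unset Printing Implicit Defensive.

(* The type T of atoms is arbitrary; [Bot] is not one of the atoms in T. *)
Inductive form (T : Type) : Type :=
| Atom of T
| Bot
| Neg of form T
| And of form T & form T
| Or of form T & form T.
Arguments Bot {T}.

Definition Imp (T : Type) (A B : form T) : form T := Or (Neg A) B.
Definition Top {T : Type} : form T := Or (Neg Bot) Bot.

Fixpoint form_tree (T : Type) (A : form T) : GenTree.tree T :=
  match A with
  | Atom p => GenTree.Leaf p
  | Bot => GenTree.Node 0 [::]
  | Neg B => GenTree.Node 1 [:: form_tree B]
  | And B C => GenTree.Node 2 [:: form_tree B; form_tree C]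
  | Or B C => GenTree.Node 3 [:: form_tree B; form_tree C]
  end.

Fixpoint tree_form (T : Type) (t : GenTree.tree T) : form T :=
  match t with
  | GenTree.Leaf p => Atom p
  | GenTree.Node 1 [:: u] => Neg (tree_form u)
  | GenTree.Node 2 [:: u; w] => And (tree_form u) (tree_form w)
  | GenTree.Node 3 [:: u; w] => Or (tree_form u) (tree_form w)
  | _ => Bot
  end.

Lemma form_treeK (T : Type) : cancel (@form_tree T) (@tree_form T).
Proof. by elim=> //= [A -> | A -> B -> | A -> B ->]. Qed.

HB.instance Definition _ (T : choiceType) :=
  Choice.copy (form T) (can_type (@form_treeK T)).

(* [LBot] and [LNegBot] are there because bottom counts as an atom when
   literals are formed. *)
Inductive literal (T : Type) : Type :=
| LAtom of T
| LNegAtom of T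
| LBot
| LNegBot
| LTop.
Arguments LBot {T}.
Arguments LNegBot {T}.
Arguments LTop {T}.

Definition lit_form (T : Type) (l : literal T) : form T :=
  match l with
  | LAtom p => Atom p
  | LNegAtom p => Neg (Atom p)
  | LBot => Bot
  | LNegBot => Neg Bot
  | LTop => Top
  end.

Definition lit_code (T : Type) (l : literal T) : option (bool * option T) :=
  match l with
  | LAtom p => Some (true, Some p)
  | LNegAtom p => Some (false, Some p)
  | LBot => Some (true, None)
  | LNegBot => Some (false, None)
  | LTop => None
  end.

Definition code_lit (T : Type) (x : option (bool * option T)) : literal T :=
  match x with
  | Some (true, Some p) => LAtom p
  | Some (false, Some p) => LNegAtom p
  | Some (true, None) => LBot
  | Some (false, None) => LNegBot
  | None => LTop
  end.

Lemma lit_codeK (T : Type) : cancel (@lit_code T) (@code_lit T).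
Proof. by case. Qed.

HB.instance Definition _ (T : choiceType) :=
  Choice.copy (literal T) (can_type (@lit_codeK T)).

Local Open Scope classical_set_scope.

Notation clause T := {fset literal T}.
Notation clause_set T := (set (clause T)).

Fixpoint eval (T : Type) (v : T -> bool) (A : form T) : bool :=
  match A with
  | Atom p => v p
  | Bot => false
  | Neg B => ~~ eval v B
  | And B C => eval v B && eval v C
  | Or B C => eval v B || eval v C
  end.

Definition valid (T : Type) (A : form T) : Prop := forall v, eval v A.

Section Semantics.
Variable T : choiceType.
Implicit Types (A B : form T) (c d : clause T) (C D : clause_set T).

Definition clause_true (v : T -> bool) c : Prop :=
  exists2 l, l \in c & eval v (lit_form l).

Definition clause_set_true (v : T -> bool) C : Prop :=
  forall c, C c -> clause_true v c.

Definition entails_clause A c : Prop :=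
  forall v, eval v A -> clause_true v c.

Fixpoint atoms A : set T :=
  match A with
  | Atom p => [set p]
  | Bot => set0
  | Neg B => atoms B
  | And B C => atoms B `|` atoms C
  | Or B C => atoms B `|` atoms C
  end.

Definition clause_set_atoms C : set T :=
  [set p | exists2 c, C c & exists2 l, l \in c & atoms (lit_form l) p].

Definition pruned C : Prop :=
  (forall p, ~ ((exists2 c, C c & LAtom p \in c) /\
                (exists2 c, C c & LNegAtom p \in c))) /\
  (forall c, C c -> LTop \notin c).

Definition interpolant A B C : Prop :=
  [/\ valid (Imp A B),
      clause_set_atoms C `<=` atoms A `&` atoms B,
      forall v, eval v A -> clause_set_true v C
    & forall v, clause_set_true v C -> eval v B].

Definition pruned_interpolant A B C : Prop :=
  [/\ pruned C, interpolant A B C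
    & forall c c', C c -> (c' `<` c)%fset -> ~ entails_clause A c'].

Definition subsumes C D : Prop :=
  forall d, D d -> exists2 c, C c & (c `<=` d)%fset.

Definition clause_set_times C D : clause_set T :=
  [set e | exists2 c, C c & exists2 d, D d & e = (c `|` d)%fset].

End Semantics.

(* Formulas built from literals by conjunction and disjunction. The literal
   top is a leaf, so that it is not confused with the disjunction of the
   literals "not bottom" and bottom that it abbreviates. *)
Inductive nnf (T : Type) : Type :=
| NLit of literal T
| NAnd of nnf T & nnf T
| NOr of nnf T & nnf T.

Fixpoint nnf_form (T : Type) (M : nnf T) : form T :=
  match M with
  | NLit l => lit_form l
  | NAnd M1 M2 => And (nnf_form M1) (nnf_form M2)
  | NOr M1 M2 => Or (nnf_form M1) (nnf_form M2)
  end.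

Fixpoint CNF (T : choiceType) (M : nnf T) : clause_set T :=
  match M with
  | NLit LTop => set0
  | NLit LBot => [set fset0]
  | NLit l => [set [fset l]%fset]
  | NAnd M1 M2 => CNF M1 `|` CNF M2
  | NOr M1 M2 => clause_set_times (CNF M1) (CNF M2)
  end.

Local Open Scope mset_scope.

(* A split sequent is a pair of multisets of formulas tagged with their side:
   G1; G2 => D1; D2 has antecedent lft G1, rgt G2 and succedent lft D1, rgt D2. *)
Notation side := bool (only parsing).
Notation lft := true (only parsing).
Notation rgt := false (only parsing).
Notation split_cedent T := {mset (side * form T)%type}%mset.

(* Cedents being multisets, no exchange rule is needed. The two-premise rules
   share their context, as in G1. *)
Inductive LK (T : choiceType) : split_cedent T -> split_cedent T -> Type :=
| AxAtom (s t : side) (p : T) : LK [mset (s, Atom p)] [mset (t, Atom p)]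
| AxBot (s : side) : LK [mset (s, Bot)] mset0
| LWeak (s : side) (A : form T) G D : LK G D -> LK ((s, A) +` G) D
| RWeak (s : side) (A : form T) G D : LK G D -> LK G ((s, A) +` D)
| LContr (s : side) (A : form T) G D :
    LK ((s, A) +` ((s, A) +` G)) D -> LK ((s, A) +` G) D
| RContr (s : side) (A : form T) G D :
    LK G ((s, A) +` ((s, A) +` D)) -> LK G ((s, A) +` D)
| LAnd1 (s : side) (A B : form T) G D :
    LK ((s, A) +` G) D -> LK ((s, And A B) +` G) D
| LAnd2 (s : side) (A B : form T) G D :
    LK ((s, B) +` G) D -> LK ((s, And A B) +` G) D
| RAnd (s : side) (A B : form T) G D :
    LK G ((s, A) +` D) -> LK G ((s, B) +` D) -> LK G ((s, And A B) +` D)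
| ROr1 (s : side) (A B : form T) G D :
    LK G ((s, A) +` D) -> LK G ((s, Or A B) +` D)
| ROr2 (s : side) (A B : form T) G D :
    LK G ((s, B) +` D) -> LK G ((s, Or A B) +` D)
| LOr (s : side) (A B : form T) G D :
    LK ((s, A) +` G) D -> LK ((s, B) +` G) D -> LK ((s, Or A B) +` G) D
| LNeg (s : side) (A : form T) G D :
    LK G ((s, A) +` D) -> LK ((s, Neg A) +` G) D
| RNeg (s : side) (A : form T) G D :
    LK ((s, A) +` G) D -> LK G ((s, Neg A) +` D).

Fixpoint maehara (T : choiceType) (G D : split_cedent T) (pi : LK G D) :
    nnf T :=
  match pi with
  | AxAtom s t p =>
      match s, t with
      | lft, lft => NLit LBot
      | rgt, rgt => NLit LTop
      | lft, rgt => NLit (LAtom p)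
      | rgt, lft => NLit (LNegAtom p)
      end
  | AxBot s => if s is lft then NLit LBot else NLit LTop
  | LWeak _ _ _ _ pi1 => maehara pi1
  | RWeak _ _ _ _ pi1 => maehara pi1
  | LContr _ _ _ _ pi1 => maehara pi1
  | RContr _ _ _ _ pi1 => maehara pi1
  | LAnd1 _ _ _ _ _ pi1 => maehara pi1
  | LAnd2 _ _ _ _ _ pi1 => maehara pi1
  | RAnd s _ _ _ _ pi1 pi2 =>
      if s is lft then NOr (maehara pi1) (maehara pi2)
      else NAnd (maehara pi1) (maehara pi2)
  | ROr1 _ _ _ _ _ pi1 => maehara pi1
  | ROr2 _ _ _ _ _ pi1 => maehara pi1
  | LOr s _ _ _ _ pi1 pi2 =>
      if s is lft then NOr (maehara pi1) (maehara pi2)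
      else NAnd (maehara pi1) (maehara pi2)
  | LNeg _ _ _ _ pi1 => maehara pi1
  | RNeg _ _ _ _ pi1 => maehara pi1
  end.

(* Main.v *)
(** Decompose [B] on the right side first and [A] on the left side afterwards.
    At a leaf [A; G => ; D] of the first phase, [C] has a clause [c] whose
    literals all occur in the leaf: otherwise, as each atom has only one polarity
    in [C], the atoms outside [G] and [D] could be chosen so that [C] is true
    while [G => D], hence [B], is false. In the second phase every leaf is an
    axiom contributing either bottom or a literal of [c], and left rules take
    disjunctions, so the interpolant of that subproof is a single clause
    contained in [c] and entailed by [A]; minimality makes it equal to [c].
    Right rules take conjunctions, so the clauses obtained all belong to [C]. *)
Require Import Defs.
From mathcomp Require Import all_boot finmap multiset boolp classical_sets.
From mathcomp Require Import zify.

Set Implicit Arguments.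
Unset Strict Implicit.
Unset Printing Implicit Defensive.

Local Open Scope classical_set_scope.

(** * Derived sequent rules and their effect on the CNF of the interpolant *)

Section Provability.
Variable T : choiceType.
Implicit Types (G D : seq (bool * form T)) (A B : form T) (S : clause_set T).

(** Cedents are lists here, so that rules act on heads and axioms are found by membership; of the
    proof only the CNF of its interpolant is remembered. *)
Definition cnf_provable G D S : Prop :=
  exists pi : LK (seq_mset G) (seq_mset D), CNF (maehara pi) = S.

Lemma cnf_provable_perm G G' D D' S :
  perm_eq G G' -> perm_eq D D' -> cnf_provable G D S -> cnf_provable G' D' S.
Proof. by rewrite /cnf_provable => /eq_seq_msetP-> /eq_seq_msetP->. Qed.

Lemma cnf_provable_LWeak x G D S :
  cnf_provable G D S -> cnf_provable (x :: G) D S.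
Proof.
case: x => s A; case=> pi <-; rewrite /cnf_provable mset_cons.
by exists (LWeak s A pi).
Qed.

Lemma cnf_provable_RWeak x G D S :
  cnf_provable G D S -> cnf_provable G (x :: D) S.
Proof.
case: x => s A; case=> pi <-; rewrite /cnf_provable mset_cons.
by exists (RWeak s A pi).
Qed.

Lemma cnf_provable_LContr x G D S :
  x \in G -> cnf_provable (x :: G) D S -> cnf_provable G D S.
Proof.
case: x => s A xG; rewrite /cnf_provable mset_cons.
have /eq_seq_msetP -> := perm_to_rem xG; rewrite mset_cons.
by case=> pi <-; exists (LContr pi).
Qed.

Lemma cnf_provable_RContr x G D S :
  x \in D -> cnf_provable G (x :: D) S -> cnf_provable G D S.
Proof.
case: x => s A xD; rewrite /cnf_provable mset_cons.
have /eq_seq_msetP -> := perm_to_rem xD; rewrite mset_cons.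
by case=> pi <-; exists (RContr pi).
Qed.

(** Weakening and contraction leave the interpolant unchanged: first all of [G'] and [D'] is added,
    then each formula of [G] and [D] is contracted into its copy in [G'] or [D']. *)
Lemma cnf_provable_subset G G' D D' S :
  {subset G <= G'} -> {subset D <= D'} ->
  cnf_provable G D S -> cnf_provable G' D' S.
Proof.
move=> sG sD pGD.
have {}pGD : cnf_provable (G ++ G') (D ++ D') S.
  apply: (@cnf_provable_perm (G' ++ G) _ (D' ++ D)).
  - by rewrite perm_catC.
  - by rewrite perm_catC.
  elim: G' {sG} => [|x G' IH] /=; last exact: cnf_provable_LWeak.
  by elim: D' {sD} => [|x D' IH] //=; apply: cnf_provable_RWeak.
have {sG} pGD : cnf_provable G' (D ++ D') S.
  elim: G sG pGD => //= x G IH sG pGD.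
  apply: IH => [y yG|]; first by rewrite sG // inE yG orbT.
  by apply: cnf_provable_LContr pGD; rewrite mem_cat sG ?inE ?eqxx ?orbT.
elim: D sD pGD => //= x D IH sD pGD.
apply: IH => [y yD|]; first by rewrite sD // inE yD orbT.
by apply: cnf_provable_RContr pGD; rewrite mem_cat sD ?inE ?eqxx ?orbT.
Qed.

(** The effect on CNFs of a binary rule whose main formula lies on side [s]: disjunction on the
    left, conjunction on the right. *)
Definition side_op (s : bool) S1 S2 : clause_set T :=
  if s then clause_set_times S1 S2 else S1 `|` S2.

Lemma cnf_provable_LNeg s A G D S :
  cnf_provable G ((s, A) :: D) S -> cnf_provable ((s, Neg A) :: G) D S.
Proof.
by rewrite /cnf_provable !mset_cons; case=> pi <-; exists (LNeg pi).
Qed.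

Lemma cnf_provable_RNeg s A G D S :
  cnf_provable ((s, A) :: G) D S -> cnf_provable G ((s, Neg A) :: D) S.
Proof.
by rewrite /cnf_provable !mset_cons; case=> pi <-; exists (RNeg pi).
Qed.

(** This invertible form of the rule loses no formula during decomposition. It comes from applying
    both G1 rules and contracting the two copies of the conjunction. *)
Lemma cnf_provable_LAnd s A B G D S :
  cnf_provable [:: (s, A), (s, B) & G] D S ->
  cnf_provable ((s, And A B) :: G) D S.
Proof.
have L1 G' : cnf_provable ((s, A) :: G') D S ->
    cnf_provable ((s, And A B) :: G') D S.
  by rewrite /cnf_provable !mset_cons; case=> pi <-; exists (LAnd1 B pi).
have L2 G' : cnf_provable ((s, B) :: G') D S ->
    cnf_provable ((s, And A B) :: G') D S.
  by rewrite /cnf_provable !mset_cons; case=> pi <-; exists (LAnd2 A pi).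
move/L1 => pG;
  apply: (@cnf_provable_subset [:: (s, And A B), (s, And A B) & G] _ D) =>
  [x||];
  [by rewrite !inE orbA orbb | by [] |].
apply: L2; apply: cnf_provable_subset pG => [x|]; [rewrite !inE|by []].
by case: (_ == _); case: (_ == _).
Qed.

Lemma cnf_provable_ROr s A B G D S :
  cnf_provable G [:: (s, A), (s, B) & D] S ->
  cnf_provable G ((s, Or A B) :: D) S.
Proof.
have R1 D' : cnf_provable G ((s, A) :: D') S ->
    cnf_provable G ((s, Or A B) :: D') S.
  by rewrite /cnf_provable !mset_cons; case=> pi <-; exists (ROr1 B pi).
have R2 D' : cnf_provable G ((s, B) :: D') S ->
    cnf_provable G ((s, Or A B) :: D') S.
  by rewrite /cnf_provable !mset_cons; case=> pi <-; exists (ROr2 A pi).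
move/R1 => pG;
  apply: (@cnf_provable_subset G _ [:: (s, Or A B), (s, Or A B) & D]) => [|x|];
  [by [] | by rewrite !inE orbA orbb |].
apply: R2; apply: cnf_provable_subset pG => [|x]; [by []|rewrite !inE].
by case: (_ == _); case: (_ == _).
Qed.

Lemma cnf_provable_RAnd s A B G D S1 S2 :
  cnf_provable G ((s, A) :: D) S1 -> cnf_provable G ((s, B) :: D) S2 ->
  cnf_provable G ((s, And A B) :: D) (side_op s S1 S2).
Proof.
rewrite /cnf_provable !mset_cons; case=> pi1 <- [pi2 <-].
by exists (RAnd pi1 pi2); case: s pi1 pi2.
Qed.

Lemma cnf_provable_LOr s A B G D S1 S2 :
  cnf_provable ((s, A) :: G) D S1 -> cnf_provable ((s, B) :: G) D S2 ->
  cnf_provable ((s, Or A B) :: G) D (side_op s S1 S2).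
Proof.
rewrite /cnf_provable !mset_cons; case=> pi1 <- [pi2 <-].
by exists (LOr pi1 pi2); case: s pi1 pi2.
Qed.

Lemma seq_mset0 : seq_mset [::] = @mset0 (bool * form T)%type.
Proof. by apply/msetP => x; rewrite mset_seqE mset0E. Qed.

Lemma seq_mset1 (x : bool * form T) : seq_mset [:: x] = [mset x]%mset.
Proof. by rewrite mset_cons seq_mset0 msetD0. Qed.

Lemma cnf_provable_AxBot s G D :
  (s, Bot) \in G -> cnf_provable G D (if s then [set fset0] else set0).
Proof.
move=> sG; apply: (@cnf_provable_subset [:: (s, Bot)] _ [::]) => [x||];
  [by rewrite inE => /eqP -> | by [] |].
rewrite /cnf_provable seq_mset0 seq_mset1.
by exists (AxBot T s); case: s {sG}.
Qed.

Lemma cnf_provable_AxAtom s t p G D :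
  (s, Atom p) \in G -> (t, Atom p) \in D ->
  cnf_provable G D
    (match s, t with
     | true, true => [set fset0]
     | false, false => set0
     | true, false => [set [fset LAtom p]%fset]
     | false, true => [set [fset LNegAtom p]%fset]
     end).
Proof.
move=> sG tD;
  apply: (@cnf_provable_subset [:: (s, Atom p)] _ [:: (t, Atom p)]) => [x|x|];
  [by rewrite inE => /eqP -> | by rewrite inE => /eqP -> |].
rewrite /cnf_provable !seq_mset1.
by exists (AxAtom s t p); case: s {sG}; case: t {tD}.
Qed.

End Provability.

(** * Decomposition of one side of a split sequent down to atomic leaves *)

Section Decomposition.
Variable T : choiceType.
Implicit Types (G D : seq (form T)) (A B : form T) (v : T -> bool).

Fixpoint form_size A : nat :=
  match A with
  | Atom _ | Bot => 0
  | Neg B => (form_size B).+1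
  | And B C | Or B C => (form_size B + form_size C).+1
  end.

Definition atomic A : bool := form_size A == 0.

(** Semantics of one half of a split sequent; no side tags are needed, since each phase decomposes a
    single side. *)
Definition seq_true v G D : bool := has (predC (eval v)) G || has (eval v) D.

Definition tag_side (s : bool) (G : seq (form T)) := [seq (s, A) | A <- G].

Lemma mem_tag_side s A G : ((s, A) \in tag_side s G) = (A \in G).
Proof. by rewrite mem_map // => x y []. Qed.

(* [K S V] is the invariant relating the clause set [S] of a subproof to the set
   [V] of valuations satisfying the part of its end-sequent on side [s]. *)
Lemma side_decomposition (s : bool) (G0 D0 : seq (bool * form T))
    (W : (T -> bool) -> Prop) (K : clause_set T -> ((T -> bool) -> bool) -> Prop) :
  (forall S1 S2 V1 V2 V, K S1 V1 -> K S2 V2 -> V =1 (fun v => V1 v && V2 v) ->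
     K (side_op s S1 S2) V) ->
  (forall G D, all atomic G -> all atomic D ->
     (forall v, W v -> seq_true v G D) ->
     exists2 S, cnf_provable (tag_side s G ++ G0) (tag_side s D ++ D0) S
              & K S (fun v => seq_true v G D)) ->
  forall G D, (forall v, W v -> seq_true v G D) ->
     exists2 S, cnf_provable (tag_side s G ++ G0) (tag_side s D ++ D0) S
              & K S (fun v => seq_true v G D).
Proof.
move=> Kop base G D.
have [n] := ubnP (sumn (map form_size G) + sumn (map form_size D)).
elim: n G D => // n IH G D.
have Kext S V V' : V =1 V' -> K S V -> K S V' by move/funext ->.
(* A compound formula of the antecedent is moved to the head and its rule applied backwards. All
   rules used are invertible, so validity over [W] passes to the premises. *)
case: (altP (@allP _ atomic G)) => [/allP aG|]; last first.
  case/allPn=> A AG nA; have pG := perm_to_rem AG.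
  have eV v : seq_true v (A :: rem A G) D = seq_true v G D.
    by rewrite /seq_true (perm_has _ pG).
  rewrite (perm_sumn (perm_map form_size pG)) => szn hW.
  suff [S pS KS] : exists2 S,
      cnf_provable (tag_side s (A :: rem A G) ++ G0) (tag_side s D ++ D0) S
      & K S (fun v => seq_true v (A :: rem A G) D).
    exists S; last exact: Kext eV KS.
    apply: cnf_provable_perm pS; last by [].
    by rewrite perm_sym perm_cat2r; apply: perm_map.
  have {}hW v : W v -> seq_true v (A :: rem A G) D by rewrite eV; apply: hW.
  move: (rem A G) szn hW {pG eV AG} => {}G.
  case: A nA => //= [A|A B|A B] _ szn hW.
  - have e v : seq_true v G (A :: D) = seq_true v (Neg A :: G) D.
      by rewrite /seq_true /= negbK; do 3 case: eval || case: has.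
    case: (IH G (A :: D)) => [|v|S pS KS]; [by move=> /=; lia | by rewrite e;
      apply: hW |].
    by exists S; [apply: cnf_provable_LNeg | apply: Kext KS].
  - have e v : seq_true v [:: A, B & G] D = seq_true v (And A B :: G) D.
      by rewrite /seq_true /= negb_and !orbA.
    case: (IH [:: A, B & G] D) => [|v|S pS KS]; [by move=> /=; lia |
      by rewrite e; apply: hW |].
    by exists S; [apply: cnf_provable_LAnd | apply: Kext KS].
  - have e v : seq_true v (Or A B :: G) D =
        seq_true v (A :: G) D && seq_true v (B :: G) D.
      by rewrite /seq_true /= negb_or; do 2 case: eval => //=;
        rewrite ?andbT ?andbb.
    case: (IH (A :: G) D) => [|v /hW|S1 p1 K1]; [by move=> /=; lia |
      by rewrite e => /andP[] |].
    case: (IH (B :: G) D) => [|v /hW|S2 p2 K2]; [by move=> /=; lia |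
      by rewrite e => /andP[] |].
    by exists (side_op s S1 S2); [apply: cnf_provable_LOr | apply: Kop K1 K2 _].
case: (altP (@allP _ atomic D)) => [/allP aD|]; first by move=> _; apply: base.
case/allPn=> A AD nA; have pD := perm_to_rem AD.
have eV v : seq_true v G (A :: rem A D) = seq_true v G D.
  by rewrite /seq_true (perm_has _ pD).
rewrite (perm_sumn (perm_map form_size pD)) => szn hW.
suff [S pS KS] : exists2 S,
    cnf_provable (tag_side s G ++ G0) (tag_side s (A :: rem A D) ++ D0) S
    & K S (fun v => seq_true v G (A :: rem A D)).
  exists S; last exact: Kext eV KS.
  apply: cnf_provable_perm pS; first by [].
  by rewrite perm_sym perm_cat2r; apply: perm_map.
have {}hW v : W v -> seq_true v G (A :: rem A D) by rewrite eV; apply: hW.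
move: (rem A D) szn hW {pD eV AD} => {}D.
case: A nA => //= [A|A B|A B] _ szn hW.
- have e v : seq_true v (A :: G) D = seq_true v G (Neg A :: D).
    by rewrite /seq_true /=; do 3 case: eval || case: has.
  case: (IH (A :: G) D) => [|v|S pS KS]; [by move=> /=; lia | by rewrite e;
    apply: hW |].
  by exists S; [apply: cnf_provable_RNeg | apply: Kext KS].
- have e v : seq_true v G (And A B :: D) =
      seq_true v G (A :: D) && seq_true v G (B :: D).
    by rewrite /seq_true /=; do 2 case: eval => //=;
      rewrite ?orbT ?andbT ?andbb.
  case: (IH G (A :: D)) => [|v /hW|S1 p1 K1]; [by move=> /=; lia |
    by rewrite e => /andP[] |].
  case: (IH G (B :: D)) => [|v /hW|S2 p2 K2]; [by move=> /=; lia |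
    by rewrite e => /andP[] |].
  by exists (side_op s S1 S2); [apply: cnf_provable_RAnd | apply: Kop K1 K2 _].
- have e v : seq_true v G [:: A, B & D] = seq_true v G (Or A B :: D).
    by rewrite /seq_true /= !orbA.
  case: (IH G [:: A, B & D]) => [|v|S pS KS]; [by move=> /=; lia |
    by rewrite e; apply: hW |].
  by exists S; [apply: cnf_provable_ROr | apply: Kext KS].
Qed.

(** Atomic formulas are atoms or bottom, so the conditions on [v] settle every formula. Both phases
    use this to refute a leaf to which no axiom applies. *)
Lemma seq_trueN v G D : all atomic G -> all atomic D -> Bot \notin G ->
  (forall p, Atom p \in G -> v p) -> (forall p, Atom p \in D -> ~~ v p) ->
  ~~ seq_true v G D.
Proof.
move=> /allP aG /allP aD nBot vG vD; rewrite negb_or; apply/andP; split.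
  apply/hasPn => A AG /=; rewrite negbK; have := aG _ AG.
  by case: A AG => //= [p /vG //|BG]; rewrite BG in nBot.
by apply/hasPn => A AD /=; have := aD _ AD; case: A AD => //= p /vD.
Qed.

Lemma seq_true_Bot v G D : Bot \in G -> seq_true v G D.
Proof. by move=> BG; apply/orP; left; apply/hasP; exists Bot. Qed.

Lemma seq_true_AxAtom v p G D :
  Atom p \in G -> Atom p \in D -> seq_true v G D.
Proof.
move=> pG pD; rewrite /seq_true; have [vp|nvp] := boolP (v p).
  by apply/orP; right; apply/hasP; exists (Atom p).
by apply/orP; left; apply/hasP; exists (Atom p).
Qed.

(** The first two hypotheses make every atom of [c] available on the right, so that a mixed axiom
    can contribute the corresponding literal of [c]. *)
Lemma left_phase A (c : clause T) G D :
  (forall p, LAtom p \in c -> Atom p \in D) ->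
  (forall p, LNegAtom p \in c -> Atom p \in G) ->
  (forall p, LAtom p \in c -> LNegAtom p \notin c) ->
  LNegBot \notin c -> LTop \notin c -> entails_clause A c ->
  exists2 d : clause T, (d `<=` c)%fset /\ entails_clause A d
    & cnf_provable ((true, A) :: tag_side false G) (tag_side false D) [set d].
Proof.
move=> cD cG cP nNB nT Ac.
(* The last condition says that [d] holds wherever the left half fails; at the root, where the left
   half is the negation of [A], it becomes entailment of [d] by [A]. *)
pose K (S : clause_set T) (V : (T -> bool) -> bool) :=
  exists d, [/\ S = [set d], (d `<=` c)%fset & forall v, V v \/ clause_true v d].
(* [W] consists of the valuations falsifying [c]; since [A] entails [c], they all falsify [A]. *)
have [S1 S2 V1 V2 V [d1 [-> d1c h1]] [d2 [-> d2c h2]] eV|||S] :=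
  @side_decomposition true (tag_side false G) (tag_side false D)
    (fun v => ~ clause_true v c) K _ _ [:: A] [::].
- exists (d1 `|` d2)%fset; split.
  + rewrite /side_op; apply/seteqP; split => e /=.
      by case=> _ -> [_ -> ->].
    by move=> ->; exists d1 => //; exists d2.
  + by rewrite fsubUset d1c.
  + move=> v; rewrite eV; case: (h1 v) => [->|[l ld lv]]; last first.
      by right; exists l; rewrite // in_fsetU ld.
    case: (h2 v) => [->|[l ld lv]]; first by left.
    by right; exists l; rewrite // in_fsetU ld orbT.
- move=> G1 D1 aG aD hW.
  have [BG|nBG] := boolP (Bot \in G1).
    exists [set fset0].
      by apply: (@cnf_provable_AxBot _ true); rewrite mem_cat mem_tag_side BG.
    by exists fset0; split; rewrite ?fsub0set// => v; left; apply: seq_true_Bot.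
  case: (pselect (exists p, Atom p \in G1 /\ Atom p \in D1)).
    case=> p [pG pD]; exists [set fset0].
      by apply: (@cnf_provable_AxAtom _ true true p);
        rewrite mem_cat mem_tag_side ?pG ?pD.
    exists fset0; split; rewrite ?fsub0set// => v; left.
    exact: seq_true_AxAtom pG pD.
  move=> nGD.
  case: (pselect (exists p, Atom p \in G1 /\ LAtom p \in c)).
    case=> p [pG pc]; exists [set [fset LAtom p]%fset].
      apply: (@cnf_provable_AxAtom _ true false p);
        rewrite mem_cat mem_tag_side ?pG//.
      by rewrite cD // orbT.
    exists [fset LAtom p]%fset; split; rewrite ?fsub1set// => v.
    have [vp|nvp] := boolP (v p).
      by right; exists (LAtom p) => //; rewrite in_fset1.
    by left; apply/orP; left; apply/hasP; exists (Atom p).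
  move=> nG.
  case: (pselect (exists p, Atom p \in D1 /\ LNegAtom p \in c)).
    case=> p [pD pc]; exists [set [fset LNegAtom p]%fset].
      apply: (@cnf_provable_AxAtom _ false true p);
        rewrite mem_cat mem_tag_side ?pD//.
      by rewrite cG // orbT.
    exists [fset LNegAtom p]%fset; split; rewrite ?fsub1set// => v.
    have [vp|nvp] := boolP (v p).
      by left; apply/orP; right; apply/hasP; exists (Atom p).
    by right; exists (LNegAtom p) => //; rewrite in_fset1.
  move=> nD; exfalso.
  (* If no axiom applied, this valuation would falsify both the leaf and every literal of [c],
     contrary to [hW]. *)
  pose v p := (Atom p \in G1) || (LNegAtom p \in c).
  have /negP[] : ~~ seq_true v G1 D1.
    apply: seq_trueN => // p; rewrite /v; first by move=> ->.
    move=> pD; apply/norP; split; apply/negP => ?; first by apply: nGD;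
      exists p.
    by apply: nD; exists p.
  apply: hW => -[l lc]; case: l lc => [p|p|||] lc //=.
  - case/orP => [pG|]; first by apply: nG; exists p.
    exact/negP/cP.
  - by rewrite /v lc orbT.
  - by rewrite lc in nNB.
  - by rewrite lc in nT.
- move=> v nc; rewrite /seq_true /= !orbF; apply/negP => /Ac; exact: nc.
move=> pS [d [eS dc hd]]; exists d; last by rewrite eS in pS.
by split=> // v Av; case: (hd v) => //; rewrite /seq_true /= Av.
Qed.

End Decomposition.

(** * The right phase and the assembly of the proof *)

Theorem theorem5p10 (T : choiceType) (A B : form T) (C : clause_set T)
    (hC : pruned_interpolant A B C) :
  exists pi : LK [mset (lft, A)]%mset [mset (rgt, B)]%mset,
    subsumes C (CNF (maehara pi)).
Proof.
case: hC => -[prP prT] [_ _ AC CB] minC.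
(* On the right side CNFs are combined by union, so the invariant [S] included in [C] needs no
   semantic part. *)
have [S1 S2 V1 V2 V|||S] :=
  @side_decomposition T false [:: (true, A)] [::] (fun v => clause_set_true v C)
    (fun S _ => S `<=` C) _ _ [::] [:: B].
- by move=> s1 s2 _ c [/s1|/s2].
- move=> G D aG aD hW.
  have [BG|nBG] := boolP (Bot \in G).
    exists set0; last by [].
    by apply: (@cnf_provable_AxBot _ false); rewrite mem_cat mem_tag_side BG.
  case: (pselect (exists p, Atom p \in G /\ Atom p \in D)).
    case=> p [pG pD]; exists set0; last by [].
    by apply: (@cnf_provable_AxAtom _ false false p);
      rewrite mem_cat mem_tag_side ?pG ?pD.
  move=> nGD.
  (* Subject to refuting the leaf, [v] favours [C]: an atom outside [G] and [D] is true exactly when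
     it occurs positively in [C]. *)
  pose v p := (Atom p \in G) ||
    ((Atom p \notin D) && `[< exists2 c, C c & LAtom p \in c >]).
  have nv : ~~ seq_true v G D.
    apply: seq_trueN => // p; rewrite /v; first by move=> ->.
    by move=> pD; rewrite pD orbF; apply/negP => pG; apply: nGD; exists p.
  have [c Cc nc] : exists2 c, C c & ~ clause_true v c.
    apply: contrapT => h; case/negP: nv; apply: hW => c Cc.
    by apply: contrapT => nc; apply: h; exists c.
  (* All literals of [c] are false at [v]. A positive one is false although it occurs positively in
     [C], so its atom is in [D]; the atom of a negative one is true and, [C] being pruned, not
     positive in [C], so it is in [G]. *)
  have [||||||d [dc Ad] pd] := @left_phase T A c G D.
  + move=> p pc; apply: contrapT => /negP pD; apply: nc; exists (LAtom p) =>
      //=.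
    by rewrite /v pD /=; apply/orP; right; apply/asboolP; exists c.
  + move=> p pc; apply: contrapT => /negP pG; apply: nc; exists (LNegAtom p) =>
      //=.
    rewrite /v (negPf pG) /= negb_and; apply/orP; right; apply/asboolPn => pos.
    by apply: (prP p); split=> //; exists c.
  + by move=> p pc; apply/negP => npc; apply: (prP p); split; exists c.
  + by apply/negP => lc; apply: nc; exists LNegBot.
  + exact: prT.
  + by move=> w Aw; apply: AC.
  exists [set d].
    apply: cnf_provable_perm pd; last by rewrite cats0.
    by rewrite perm_sym cats1 perm_rcons.
  (* Minimality of [c] excludes a proper subclause [d] entailed by [A]. *)
  move=> _ ->; have [->//|ndc] := eqVneq d c.
  by case: (minC c d Cc _ Ad); rewrite fproperEneq ndc.
- by move=> v /CB; rewrite /seq_true /= orbF.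
case=> /= pi <- sub; move: pi sub; rewrite !seq_mset1 => pi sub.
(* The CNF is even a subset of [C], so each of its clauses is subsumed by itself. *)
by exists pi => d /sub Cd; exists d.
Qed.
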